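(* For each $\beta\in[0,m]$, the set $\mathcal{S}_\beta:=\{\vartheta\in\Omega(\mathbb{R}^m):\dim_L(\vartheta)=\beta\}$ is dense in $\Omega(\mathbb{R}^m)$ with respect to $d_L$.
   Context: $\Omega(\mathbb{R}^m)$ is the set of all Borel probability measures on $\mathbb{R}^m$ (with the Euclidean norm $\|\cdot\|_2$), endowed with $$d_L(\vartheta,\theta)=\sup_{h\in\mathrm{Lip}_1(\mathbb{R}^m)}\Big|\int_{\mathbb{R}^m}h\,d\vartheta-\int_{\mathbb{R}^m}h\,d\theta\Big|,$$ where $\mathrm{Lip}_1(\mathbb{R}^m)$ is the set of Lipschitz functions $h:\mathbb{R}^m\to\mathbb{R}$ with Lipschitz constant at most $1$. For a Borel probability measure $\vartheta$ on $\mathbb{R}^m$ with support $\mathrm{supp}(\vartheta)$ of diameter $|\mathrm{supp}(\vartheta)|>0$, the lower dimension is $$\dim_L(\vartheta)=\sup\Big\{\beta\ge0:\exists M>0\text{ such that }\forall\,0<r<R\le|\mathrm{supp}(\vartheta)|\text{ and }x\in\mathrm{supp}(\vartheta),\ \frac{\vartheta(\mathcal{B}_R(x))}{\vartheta(\mathcal{B}_r(x))}\ge M\Big(\frac{R}{r}\Big)^\beta\Big\},$$ where $\mathcal{B}_R(x)=\{y\in\mathbb{R}^m:\|y-x\|_2\le R\}$ and $R$ ranges over finite values; if $|\mathrm{supp}(\vartheta)|=0$, then $\dim_L(\vartheta)=0$.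
   Formalization: Ω(R^m) is restricted to Borel probability measures with finite first moment: otherwise d_L is undefined or infinite, and for β>0 a measure of infinite first moment is at infinite d_L-distance from every element of S_β, whose elements have bounded support. *)

(* Defs.v *)
From HB Require Import structures.
From mathcomp Require Import all_boot all_order all_algebra.
From mathcomp Require Import all_classical all_reals all_analysis.
From mathcomp Require Import measurable_realfun.

Set Implicit Arguments.
Unset Strict Implicit.
Unset Printing Implicit Defensive.

Import Order.TTheory GRing.Theory Num.Theory.
Import numFieldNormedType.Exports.

Local Open Scope classical_set_scope.
Local Open Scope ring_scope.

Section Euclidean.
Context (R : realType) (m : nat).
Implicit Types (x y : 'rV[R]_m) (h : 'rV[R]_m -> R).

(* The library's norm on ['rV[R]_m] is the sup norm; it induces the same
   topology, and hence the same Borel sets, as the Euclidean norm. *)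
Definition enorm x : R := Num.sqrt (\sum_(i < m) x ord0 i ^+ 2).

Definition ecball x (r : R) : set 'rV[R]_m := [set y | enorm (y - x) <= r].

Definition diam (A : set 'rV[R]_m) : \bar R :=
  ereal_sup [set (enorm (p.1 - p.2))%:E | p in A `*` A].

Definition Lip1 : set ('rV[R]_m -> R) :=
  [set h | forall x y, `|h x - h y| <= enorm (x - y)].

Definition borelRV := g_sigma_algebraType (@open 'rV[R]_m).

End Euclidean.

(* A finite first moment is exactly what makes every 1-Lipschitz function
   integrable (see [Lip1_integrable]), so that the distance [dL] is defined and
   finite. A probability measure without it is at infinite [dL]-distance from
   every compactly supported one, hence from every measure of positive lower
   dimension (such a measure has bounded support). *)
Record Omega (R : realType) (m : nat) := MkOmega {
  law :> probability (borelRV R m) R ;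
  law_moment : (\int[law]_x (enorm x)%:E < +oo)%E }.

HB.instance Definition _ (R : realType) (m : nat) := gen_eqMixin (Omega R m).
HB.instance Definition _ (R : realType) (m : nat) :=
  gen_choiceMixin (Omega R m).

Section Kantorovich.
Context (R : realType) (m : nat).
Implicit Types (mu nu : Omega R m).

Lemma enorm_ge0 (x : 'rV[R]_m) : 0 <= enorm x.
Proof. exact: sqrtr_ge0. Qed.

Lemma enorm_le_mx_norm (x : 'rV[R]_m) : enorm x <= m%:R * `|x|.
Proof.
have xi i : `|x ord0 i| <= `|x|.
  by rewrite [leRHS]/Num.norm/= mx_normrE; apply: (le_bigmax _ _ (ord0, i)).
rewrite -(@ler_pXn2r _ 2) ?nnegrE ?enorm_ge0 ?mulr_ge0//.
rewrite sqr_sqrtr; last by apply: sumr_ge0 => i _; exact: sqr_ge0.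
apply: (@le_trans _ _ (\sum_(i < m) `|x| ^+ 2)).
  by apply: ler_sum => i _; rewrite -real_normK ?num_real// lerXn2r ?nnegrE.
rewrite sumr_const card_ord -[leLHS]mulr_natl exprMn ler_wpM2r ?sqr_ge0//.
by rewrite -natrX ler_nat; case: (m) => // k; rewrite leq_pmulr.
Qed.

Lemma continuous_enorm : continuous (@enorm R m).
Proof.
have cs (r : seq 'I_m) :
    continuous (fun y : 'rV[R]_m => \sum_(i <- r) y ord0 i ^+ 2).
  elim: r => [|i r IHr].
    by under eq_fun do rewrite big_nil; exact: cst_continuous.
  under eq_fun do rewrite big_cons; move=> x.
  have ci := @coord_continuous R 1 m ord0 i x.
  exact: (cvgD (cvgM ci ci) (IHr x)).
by move=> x; apply: continuous_comp; [exact: cs | exact: sqrt_continuous].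
Qed.

Lemma Lip1_continuous (h : 'rV[R]_m -> R) : Lip1 h -> continuous h.
Proof.
move=> hh x; apply/(@cvgrPdist_le _ _ _ _ (nbhs_filter x)) => e e0.
have k0 : 0 < m%:R + 1 :> R by rewrite ltr_wpDl.
have := nbhsx_ballx x _ (divr_gt0 e0 k0).
apply: filterS => y; rewrite -ball_normE /= => /ltW xy.
apply: (le_trans (hh _ _)); apply: (le_trans (enorm_le_mx_norm _)).
apply: (@le_trans _ _ ((m%:R + 1) * `|x - y|)).
  by apply: ler_wpM2r => //; rewrite lerDl.
by rewrite mulrC -ler_pdivlMr.
Qed.

Lemma measurable_continuous_borelRV (h : 'rV[R]_m -> R) :
  continuous h -> measurable_fun [set: borelRV R m] (h : borelRV R m -> R).
Proof.
move=> /continuousP ch; apply: (measurability _ (RGenOpens.measurableE R)).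
move=> _ [_ [a [b ->] <-]]; rewrite setTI; apply: sub_sigma_algebra.
exact/ch/interval_open.
Qed.

Lemma Lip1_integrable mu (h : 'rV[R]_m -> R) :
  Lip1 h -> mu.-integrable setT (EFin \o h : borelRV R m -> \bar R).
Proof.
move=> hh; have mh := measurable_continuous_borelRV (Lip1_continuous hh).
have ie : mu.-integrable setT (EFin \o @enorm R m : borelRV R m -> \bar R).
  apply/integrableP; split.
    apply/measurable_EFinP; apply: measurable_continuous_borelRV.
    exact: continuous_enorm.
  apply: le_lt_trans (law_moment mu); rewrite le_eqVlt; apply/orP; left.
  by apply/eqP/eq_integral => x _ /=; rewrite ger0_norm ?enorm_ge0.
have ic : mu.-integrable setT (cst `|h 0|%:E : borelRV R m -> \bar R).
  exact: finite_measure_integrable_cst.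
apply: le_integrable (integrableD measurableT ic ie) => //.
  exact/measurable_EFinP.
move=> x _ /=; rewrite lee_fin.
rewrite [leRHS]ger0_norm ?addr_ge0 ?enorm_ge0// -lerBlDl.
by rewrite (le_trans (lerB_dist _ _))// (le_trans (hh _ _))// subr0.
Qed.

(* The integrals are real-valued ([Rintegral]); by [Lip1_integrable] no default
   value is involved. *)
Definition dL mu nu : \bar R :=
  ereal_sup [set (`| \int[mu]_x h x - \int[nu]_x h x |)%:E
            | h in @Lip1 R m].

Lemma dL_ub mu nu (h : 'rV[R]_m -> R) : Lip1 h ->
  ((`| \int[mu]_x h x - \int[nu]_x h x |)%:E <= dL mu nu)%E.
Proof. by move=> hh; apply: ereal_sup_ubound; exists h. Qed.

Lemma dLxx mu : dL mu mu = 0%E.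
Proof.
apply/eqP; rewrite eq_le; apply/andP; split.
  by apply: ge_ereal_sup => _ [h _ <-]; rewrite subrr normr0.
apply: ereal_sup_ubound; exists (cst 0); last by rewrite subrr normr0.
by move=> x y /=; rewrite subrr normr0 enorm_ge0.
Qed.

Lemma dL_sym mu nu : dL mu nu = dL nu mu.
Proof. by congr ereal_sup; apply: eq_imagel => h _; rewrite distrC. Qed.

Lemma dL_triangle mu nu xi : (dL mu xi <= dL mu nu + dL nu xi)%E.
Proof.
apply: ge_ereal_sup => _ [h hh <-].
apply: le_trans (leeD (dL_ub mu nu hh) (dL_ub nu xi hh)).
by rewrite -EFinD lee_fin ler_distD.
Qed.

Definition dL_ball mu (e : R) : set (Omega R m) := [set nu | (dL mu nu < e%:E)%E].

Lemma dL_ball_center mu (e : R) : 0 < e -> dL_ball mu e mu.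
Proof. by move=> e0; rewrite /dL_ball/= dLxx lte_fin. Qed.

Lemma dL_ball_sym mu nu (e : R) : dL_ball mu e nu -> dL_ball nu e mu.
Proof. by rewrite /dL_ball/= dL_sym. Qed.

Lemma dL_ball_triangle mu nu xi (e1 e2 : R) :
  dL_ball mu e1 nu -> dL_ball nu e2 xi -> dL_ball mu (e1 + e2) xi.
Proof.
rewrite /dL_ball/= => h1 h2; apply: le_lt_trans (dL_triangle mu nu xi) _.
by rewrite EFinD; exact: lteD.
Qed.

End Kantorovich.

HB.instance Definition _ (R : realType) (m : nat) :=
  hasNbhs.Build (Omega R m) (nbhs_ (entourage_ (@dL_ball R m))).
HB.instance Definition _ (R : realType) (m : nat) :=
  @Nbhs_isPseudoMetric.Build R (Omega R m) (entourage_ (@dL_ball R m))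
    erefl (@dL_ball R m) (@dL_ball_center R m) (@dL_ball_sym R m)
    (@dL_ball_triangle R m) erefl.

Lemma denseOmegaP (R : realType) (m : nat) (S : set (Omega R m)) :
  dense S <-> forall mu (e : R), 0 < e -> exists2 nu, S nu & (dL mu nu < e%:E)%E.
Proof.
split=> [dS mu e e0|H O [mu Omu] oO].
  have := dS (interior (ball mu e)).
  case=> [||nu [/interior_subset bnu Snu]]; last by exists nu.
    exists mu; exact: nbhsx_ballx.
  exact: open_interior.
have : nbhs mu O by exact: open_nbhs_nbhs.
rewrite -nbhs_ballE => -[e /= e0 eO].
have [nu Snu h] := H mu e e0.
by exists nu; split => //; apply: eO.
Qed.

Section LowerDimension.
Context (R : realType) (m : nat).
Implicit Types (mu : probability (borelRV R m) R).

Definition supp mu : set 'rV[R]_m :=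
  [set x | forall U, open_nbhs x U -> (0 < mu U)%E].

(* [fine] loses nothing as [mu] is finite, and the denominator is positive as
   [x] lies in the support. *)
Definition lower_exponents mu : set R :=
  [set beta | 0 <= beta /\ exists2 M : R, 0 < M &
    forall (r r' : R) (x : 'rV[R]_m), 0 < r -> r < r' ->
      (r'%:E <= diam (supp mu))%E -> supp mu x ->
      M * (r' / r) `^ beta <= fine (mu (ecball x r')) / fine (mu (ecball x r))].

Definition lower_dim mu : \bar R :=
  if (0 < diam (supp mu))%E then ereal_sup (EFin @` lower_exponents mu) else 0%E.

Definition lower_dim_level (beta : R) : set (Omega R m) :=
  [set mu | lower_dim mu = beta%:E].

End LowerDimension.

(* Main.v *)
From HB Require Import structures.
Require Import Defs.
From mathcomp Require Import all_boot all_order all_algebra.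
From mathcomp Require Import all_classical all_reals all_analysis.
From mathcomp Require Import measurable_realfun ring lra.

(* Let [L] be the law of a vector of [m] independent coordinates distributed as
   [U `^ (m / beta)], with [U] uniform on [0, 1] (the Dirac mass at [0] if
   [beta = 0]). For some [c > 0] the cubes satisfy
     [L (cube x r') >= c * (r' / r) `^ beta * L (cube x r)]
   for ALL points [x], not only those of the support, and all
   [0 < r < r' <= 1], whereas [L (cube 0 r) >= r `^ beta]. Quantifying over all
   [x] makes the growth inequality stable under mixtures of translates, so it
   passes to the law [nu] of [f X + d *: Y], where [X] has law [mu], [Y] has law
   [L] independently of [X], and [f] collapses a small cube around a point [a] of
   the support of [mu], as well as the complement of a large cube, to [a].
   As [f X] is bounded, the growth inequality gives [lower_dim nu >= beta]; as
   [f X] has an atom at [a], [nu (cube a r)] is at least a constant times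
   [r `^ beta], whence [lower_dim nu <= beta]. The coupling of [X] with
   [f X + d *: Y] bounds [dL mu nu], by the finiteness of the first moment. *)

Set Implicit Arguments.
Unset Strict Implicit.
Unset Printing Implicit Defensive.

Import Order.TTheory GRing.Theory Num.Theory.
Import numFieldNormedType.Exports.

Local Open Scope classical_set_scope.
Local Open Scope ring_scope.

Local Notation seg x r := [set y | (`|y - x| <= r)%R].

(** * A one-dimensional law of given exponent *)

(** Tangent line at 1 of the concave power t^s. It is Young's inequality for t^s and 1 with
    conjugate exponents [s^-1] and [(1 - s)^-1]; the second degenerates at [s = 1], hence the
    separate case. *)
Lemma powR_le_affine (R : realType) (s t : R) :
  0 < s <= 1 -> 0 <= t -> t `^ s <= 1 - s * (1 - t).
Proof.
move=> /andP[s0]; rewrite le_eqVlt => /predU1P[->|s1] t0.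
  by rewrite powRr1//; lra.
have := @conjugate_powR R (t `^ s) 1 s^-1 (1 - s)^-1 (powR_ge0 _ _) ler01.
rewrite !invr_gt0 subr_gt0 !invrK => /(_ s0 s1).
rewrite -powRrM mulfV ?gt_eqF// powRr1// powR1 mulr1 addrC subrK => /(_ erefl).
lra.
Qed.

(** After division by a^s this reads (b/a)^s - 1 <= b/a - 1, clear since b/a >= 1 and s <= 1. It
    bounds increments of the distribution function y^s from above. *)
Lemma powR_sub_le (R : realType) (s a b : R) :
  s <= 1 -> 0 < a -> a <= b -> b `^ s - a `^ s <= a `^ s / a * (b - a).
Proof.
move=> s1 a0 ab.
have ba : 1 <= b / a by rewrite ler_pdivlMr// mul1r.
have h := ler1_powR ba s1.
have -> : b = b / a * a by rewrite divfK// gt_eqF.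
rewrite powRM ?(ltW a0)// ?(le_trans ler01)//.
have -> : a `^ s / a * (b / a * a - a) = (b / a - 1) * a `^ s by field; rewrite gt_eqF.
by rewrite mulrBl mul1r lerB// ler_wpM2r ?powR_ge0//.
Qed.

(** Concavity again: the tangent of y^s at [b] lies above the curve. It is [powR_le_affine] at
    [a / b], scaled by b^s, and serves as the matching lower bound. *)
Lemma powR_sub_ge (R : realType) (s a b : R) :
  0 < s <= 1 -> 0 <= a -> 0 < b -> s * (b `^ s / b) * (b - a) <= b `^ s - a `^ s.
Proof.
move=> s1 a0 b0.
have h : (a / b) `^ s <= 1 - s * (1 - a / b).
  by apply: powR_le_affine => //; rewrite divr_ge0// ltW.
have {2}-> : a = a / b * b by rewrite divfK// gt_eqF.
rewrite powRM ?(ltW b0)// ?divr_ge0 ?(ltW b0)//.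
have -> : s * (b `^ s / b) * (b - a) = s * (1 - a / b) * b `^ s.
  by field; rewrite gt_eqF.
have := ler_wpM2r (powR_ge0 b s) h; lra.
Qed.

Lemma lebesgue_measure_segment (R : realType) (a b : R) : a <= b ->
  lebesgue_measure `[a, b] = (b - a)%:E.
Proof.
rewrite lebesgue_measure_itv /= lte_fin le_eqVlt => /predU1P[->|->//].
by rewrite ltxx subrr.
Qed.

Section power_law.
Context (R : realType) (s : R).
Hypothesis s01 : 0 < s <= 1.

Let s0 : 0 < s. Proof. by case/andP: s01. Qed.
Let s1 : s <= 1. Proof. by case/andP: s01. Qed.

Lemma uniform01E (A : set R) : measurable A ->
  uniform_prob (@ltr01 R) A = lebesgue_measure (A `&` `[0, 1]).
Proof.
move=> mA; rewrite /uniform_prob integral_uniform_pdf.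
rewrite (eq_integral (cst 1%E)) ?integral_cst ?mul1e//.
- exact: measurableI.
- by move=> x; rewrite inE/= in_itv/= /uniform_pdf => -[_ ->]; rewrite subr0 invr1.
Qed.

Let q : measurableTypeR R -> measurableTypeR R := fun u => u `^ s^-1.

Let mq : measurable_fun setT q.
Proof. exact: measurable_powR. Qed.

HB.instance Definition _ := isMeasurableFun.Build _ _ _ _ q mq.

(** Inverse-transform sampling: [q] is the quantile function of the law on [0, 1] with distribution
    function y^s, that is, the Beta(s, 1) law. *)
Definition power_law : probability (measurableTypeR R) R :=
  distribution (uniform_prob (@ltr01 R)) q.

Let qK a : 0 <= a -> (a `^ s) `^ s^-1 = a.
Proof. by move=> a0; rewrite -powRrM mulfV ?gt_eqF// powRr1. Qed.

Let Kq a : 0 <= a -> (a `^ s^-1) `^ s = a.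
Proof. by move=> a0; rewrite -powRrM mulVf ?gt_eqF// powRr1. Qed.

Lemma power_law_ge (A : set R) (a b : R) : measurable A ->
  0 <= a -> a <= b -> b <= 1 -> `[a, b] `<=` A ->
  ((b `^ s - a `^ s)%:E <= power_law A)%E.
Proof.
move=> mA a0 ab b1 abA.
have mqA : measurable (q @^-1` A) by rewrite -[X in measurable X]setTI; exact: mq.
rewrite /power_law/= /distribution/= /pushforward/= uniform01E//.
have <- : lebesgue_measure `[a `^ s, b `^ s] = (b `^ s - a `^ s)%:E.
  by rewrite lebesgue_measure_segment// ge0_ler_powR// ?nnegrE//; [exact: ltW|exact: le_trans ab].
apply: le_measure; rewrite ?inE//; first exact: measurableI.
move=> u /=; rewrite !in_itv/= => /andP[au ub].
have u0 : 0 <= u by rewrite (le_trans _ au)// powR_ge0.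
split; last first.
  rewrite u0 (le_trans ub)// [leRHS](_ : 1 = 1 `^ s); last by rewrite powR1.
  by rewrite ge0_ler_powR ?nnegrE ?(ltW s0)// (le_trans a0).
apply: abA => /=; rewrite in_itv/= /q.
have b0 := le_trans a0 ab.
apply/andP; split; [rewrite -(qK a0)|rewrite -[leRHS](qK b0)];
  by rewrite ge0_ler_powR ?invr_ge0 ?nnegrE ?powR_ge0 ?(ltW s0).
Qed.

(** Only the nonnegative points of [A] count, as [q] takes nonnegative values. Unlike in
    [power_law_ge], [b] may exceed 1. *)
Lemma power_law_le (A : set R) (a b : R) : measurable A ->
  0 <= a -> a <= b -> (forall y, 0 <= y -> A y -> a <= y <= b) ->
  (power_law A <= (b `^ s - a `^ s)%:E)%E.
Proof.
move=> mA a0 ab abA.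
have mqA : measurable (q @^-1` A) by rewrite -[X in measurable X]setTI; exact: mq.
rewrite /power_law/= /distribution/= /pushforward/= uniform01E//.
have <- : lebesgue_measure `[a `^ s, b `^ s] = (b `^ s - a `^ s)%:E.
  by rewrite lebesgue_measure_segment// ge0_ler_powR// ?nnegrE//; [exact: ltW|exact: le_trans ab].
apply: le_measure; rewrite ?inE//; first exact: measurableI.
move=> u /=; rewrite !in_itv/= => -[Au /andP[u0 u1]].
have /andP[au ub] := abA _ (powR_ge0 _ _) Au.
by rewrite -(Kq u0) !ge0_ler_powR ?nnegrE ?powR_ge0 ?(ltW s0) ?(le_trans a0 ab).
Qed.

Lemma power_law_eq0 (A : set R) : measurable A ->
  (forall y, 0 <= y -> ~ A y) -> power_law A = 0%E.
Proof.
move=> mA A0; apply/eqP; rewrite eq_le measure_ge0 andbT.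
by have := @power_law_le A 0 0 mA; rewrite subrr; apply=> // y /A0.
Qed.

Lemma measurable_segment (x r : R) : measurable [set y : R | `|y - x| <= r].
Proof.
rewrite (_ : mkset _ = `[x - r, x + r]%classic)//.
by apply/seteqP; split=> y /=; rewrite in_itv/= ler_distl.
Qed.

Lemma power_law_segment1 : power_law (seg 0 1) = 1%E.
Proof.
apply/eqP; rewrite eq_le probability_le1 ?andTb; last exact: measurable_segment.
rewrite -[X in (X <= _)%E](_ : (1 `^ s - 0 `^ s)%:E = 1%E).
  apply: power_law_ge => //; first exact: measurable_segment.
  by move=> y /=; rewrite in_itv/= => /andP[y0 y1]; rewrite subr0 ger0_norm.
by rewrite powR1 powR0 ?subr0// gt_eqF.
Qed.

Lemma power_law_segment0 (r : R) : 0 < r <= 1 ->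
  ((r `^ s)%:E <= power_law (seg 0 r))%E.
Proof.
move=> /andP[r0 r1].
rewrite -[X in (X <= _)%E](_ : (r `^ s - 0 `^ s)%:E = _).
  apply: power_law_ge => //; first exact: measurable_segment.
    exact: ltW.
  by move=> y /=; rewrite in_itv/= => /andP[y0 y1]; rewrite subr0 ger0_norm.
by rewrite powR0 ?subr0// gt_eqF.
Qed.

(** The density is s y^(s-1) on [0, 1]. The cases follow the position of [x] relative to 0, to the
    two radii and to the right end 1; the factor 1/8 absorbs the loss in the worst of them. *)
Lemma power_law_growth (x r r' : R) : 0 < r -> r < r' -> r' <= 1 ->
  ((s / 8 * (r' / r) `^ s)%:E * power_law (seg x r) <=
   power_law (seg x r'))%E.
Proof.
move=> r0 rr' r'1.
have mS := measurable_segment.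
have r'0 : 0 < r' by lra.
have [sgt0 sle1] := (s0, s1).
have ratio0 : 0 <= s / 8 * (r' / r) `^ s.
  by rewrite mulr_ge0 ?powR_ge0// divr_ge0// ltW.
have rat1 : 1 <= r' / r by rewrite ler_pdivlMr// mul1r ltW.
have red (u v : R) : (power_law (seg x r) <= u%:E)%E ->
    (v%:E <= power_law (seg x r'))%E ->
    s / 8 * (r' / r) `^ s * u <= v ->
  ((s / 8 * (r' / r) `^ s)%:E * power_law (seg x r) <=
   power_law (seg x r'))%E.
  move=> hu hv huv; apply: le_trans hv; apply: (@le_trans _ _ ((s / 8 * (r' / r) `^ s)%:E * u%:E)%E).
    by apply: lee_wpmul2l; rewrite ?lee_fin.
  by rewrite -EFinM lee_fin.
have powdiv : (r' / r) `^ s = r' `^ s / r `^ s.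
  rewrite powRM ?invr_ge0 ?ltW//; congr (_ * _).
  by rewrite -powR_inv1 ?ltW// powRAC powR_inv1// powR_ge0.
have rs0 : 0 < r `^ s by apply: powR_gt0.
have r's0 : 0 < r' `^ s by apply: powR_gt0.
(* For comparable radii the factor is at most s/4 <= 1, so monotonicity suffices. Afterwards
   [2 * r <= r']. *)
have [r2|r2] := ltP r' (2 * r).
  apply: (@le_trans _ _ (1%:E * power_law (seg x r))%E).
    apply: lee_wpmul2r; rewrite ?measure_ge0// lee_fin.
    have : (r' / r) `^ s <= 2.
      apply: le_trans (ler1_powR rat1 s1) _; rewrite ler_pdivrMr//; lra.
    nra.
  rewrite mul1e; apply: le_measure; rewrite ?inE; do ?exact: mS.
  by move=> y /= /le_trans; apply; exact: ltW.
have [xr|xr] := ltP x (- r).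
  by rewrite power_law_eq0 ?mule0 ?measure_ge0// => y y0 /=; rewrite ler_distl => /andP[]; lra.
(* Near 0: the nonnegative part of [seg x r] lies in [0, 3r], while [seg x r'] contains [0, r'/2],
   because -r <= x <= 2r <= r'. *)
have [x2|x2] := leP x (2 * r).
  apply: (red (3 * r `^ s) (r' `^ s / 2)).
  - apply: le_trans (@power_law_le _ 0 (3 * r) _ _ _ _) _ => //; first lra.
      by move=> y y0 /=; rewrite ler_distl => /andP[]; lra.
    rewrite lee_fin powR0 ?gt_eqF// subr0 powRM ?(ltW r0)// ler_wpM2r ?(ltW rs0)//.
    by apply: ler1_powR => //; lra.
  - apply: le_trans (@power_law_ge _ 0 (r' / 2) _ _ _ _ _); rewrite ?lee_fin//; try lra.
      rewrite powR0 ?gt_eqF// subr0 powRM ?(ltW r'0)// ler_wpM2l ?(ltW r's0)//.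
      by apply: ger1_powR => //; lra.
    by move=> y /=; rewrite in_itv/= ler_distl; lra.
  - rewrite powdiv (_ : _ * (3 * _) = 3 * s / 8 * r' `^ s); first by nra.
    by field; rewrite gt_eqF.
have x0 : 0 < x by lra.
have xs0 : 0 < x `^ s by apply: powR_gt0.
(* Away from 0 the mass is of order r x^(s-1). The constant 4 is the length 2r times the loss 2 from
   x - r >= x/2. *)
have up : (power_law (seg x r) <= (4 * (r / x) * x `^ s)%:E)%E.
  apply: le_trans (@power_law_le (seg x r) (x - r) (x + r) (mS x r) _ _ _) _; [lra|lra| |].
    by move=> y y0 /=; rewrite ler_distl.
  have -> : 4 * (r / x) * x `^ s = 2 * r * (x `^ s / (x / 2)).
    by field; rewrite gt_eqF.
  rewrite lee_fin; apply: le_trans (powR_sub_le s1 _ _) _; try lra.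
  rewrite [leLHS]mulrC (_ : x + r - (x - r) = 2 * r); last by ring.
  apply: ler_wpM2l; first lra.
  apply: ler_pM; rewrite ?powR_ge0 ?invr_ge0//; first lra.
    by apply: ge0_ler_powR; rewrite ?nnegrE; lra.
  by rewrite lef_pV2 ?posrE; lra.
have rx1 : r / x <= 1 by rewrite ler_pdivrMr//; lra.
have rx0 : 0 < r / x by apply: divr_gt0.
have le_xr : (r / x) * x `^ s <= r `^ s.
  apply: (@le_trans _ _ ((r / x) `^ s * x `^ s)).
    by apply: ler_wpM2r; rewrite ?powR_ge0//; apply: ger1_powR; rewrite ?rx0.
  by rewrite -powRM ?(ltW rx0) ?(ltW x0)// divfK ?gt_eqF.
(* If x < r', the larger segment contains [0, r'], of mass r'^s. *)
have [xr'|r'x] := ltP x r'.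
  apply: (red _ (r' `^ s) up).
    apply: le_trans (@power_law_ge _ 0 r' _ _ _ _ _); rewrite ?lee_fin ?powR0 ?gt_eqF ?subr0//; try lra.
    by move=> y /=; rewrite in_itv/= ler_distl; lra.
  rewrite powdiv.
  apply: (@le_trans _ _ (s / 8 * (r' `^ s / r `^ s) * (4 * r `^ s))).
    by apply: ler_wpM2l; [rewrite -powdiv | rewrite -mulrA ler_wpM2l].
  by rewrite (_ : _ * (4 * _) = s / 2 * r' `^ s); [nra | field; rewrite gt_eqF].
(* Now r' <= x, where masses scale linearly in the radius. Replacing (r'/r)^s by r'/r leaves a lower
   bound of order r' x^(s-1) to prove. *)
have rats : (r' / r) `^ s <= r' / r by apply: ler1_powR.
have fin1 (v : R) : s / 2 * (r' / x * x `^ s) <= v ->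
    s / 8 * (r' / r) `^ s * (4 * (r / x) * x `^ s) <= v.
  apply: le_trans; apply: (@le_trans _ _ (s / 8 * (r' / r) * (4 * (r / x) * x `^ s))).
    apply: ler_wpM2r; first by rewrite -mulrA mulr_ge0// (mulr_ge0 (ltW rx0) (ltW xs0)).
    by apply: ler_wpM2l => //; lra.
  by rewrite le_eqVlt; apply/orP; left; apply/eqP; field; rewrite !gt_eqF.
have sr0 : 0 <= r' / x * x `^ s by rewrite !mulr_ge0 ?invr_ge0 ?(ltW r'0) ?(ltW x0) ?(ltW xs0).
have [x1|x1] := leP x 1.
  apply: (red _ (x `^ s - (x - r') `^ s) up).
    apply: power_law_ge => //; try lra.
    by move=> y /=; rewrite in_itv/= ler_distl; lra.
  apply: fin1; apply: le_trans (powR_sub_ge s01 _ x0); last lra.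
  rewrite (_ : s * (x `^ s / x) * _ = s * (r' / x * x `^ s)); first by nra.
  by field; rewrite gt_eqF.
have [xr1|xr1] := ltP (1 + r) x.
  (* here [seg x r] misses [0, 1] *)
  have -> : power_law (seg x r) = 0%E.
    apply/eqP; rewrite eq_le measure_ge0 andbT.
    have := probability_setC power_law (mS 0 1).
    rewrite power_law_segment1 subee// => <-.
    apply: le_measure; rewrite ?inE; [exact: mS|exact: measurableC (mS _ _)|].
    move=> y /=; rewrite ler_distl => /andP[h1 h2]; rewrite ler_distl.
    by apply/negP; rewrite negb_and -!ltNge; apply/orP; right; lra.
  by rewrite mule0 measure_ge0.
(* Here 1 < x <= 1 + r, and [x - r', 1] still has length at least r' - r >= r'/2. *)
apply: (red _ (1 `^ s - (x - r') `^ s) up).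
  apply: power_law_ge => //; try lra.
  by move=> y /=; rewrite in_itv/= ler_distl; lra.
apply: fin1; apply: le_trans (powR_sub_ge s01 _ ltr01); last lra.
rewrite powR1 divr1 mulr1.
have : x `^ s / x <= 1 by rewrite ler_pdivrMr// mul1r ler1_powR// ltW.
have -> : r' / x * x `^ s = r' * (x `^ s / x) by field; rewrite gt_eqF.
move=> h; have : r' * (x `^ s / x) <= r' by rewrite ler_piMr// ltW.
nra.
Qed.

End power_law.

Lemma exists_law_exponent (R : realType) (s : R) : 0 <= s <= 1 ->
  exists (P : probability (measurableTypeR R) R) (c : R), [/\ 0 < c,
    forall x r r', 0 < r -> r < r' -> r' <= 1 ->
      ((c * (r' / r) `^ s)%:E * P (seg x r) <=
       P (seg x r'))%E,
    forall r, 0 < r <= 1 -> ((r `^ s)%:E <= P (seg 0 r))%E &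
    P (seg 0 1) = 1%E].
Proof.
move=> /andP[]; rewrite le_eqVlt => /predU1P[<- _|s0 s1].
  exists (\d_(0 : measurableTypeR R)), 1; split=> //.
  - move=> x r r' r0 rr' _; rewrite powRr0 mulr1 mul1e; apply: le_measure; rewrite ?inE; do ?exact: measurable_segment.
    by move=> y /= /le_trans; apply; exact: ltW.
  - by move=> r /andP[r0 _]; rewrite powRr0 /= diracE mem_set//= subrr normr0 ltW.
  - by rewrite /= diracE mem_set//= subrr normr0.
have s01 : 0 < s <= 1 by rewrite s0.
exists (power_law s), (s / 8); split.
- by rewrite divr_gt0.
- by move=> x r r' *; apply: power_law_growth.
- by move=> r *; apply: power_law_segment0.
- exact: power_law_segment1.
Qed.

(** * Borel sets of row vectors and supports *)

Section cubes.
Context (R : realType) (m : nat).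
Implicit Types (x y : 'rV[R]_m) (r : R).

(** Closed sup-norm balls: product laws factor over them, and they are comparable with Euclidean
    balls. *)
Definition cube x r : set 'rV[R]_m := [set y | forall i, `|y ord0 i - x ord0 i| <= r].

Lemma measurable_coord (i : 'I_m) :
  measurable_fun setT (fun y : borelRV R m => y ord0 i : R).
Proof. by apply: measurable_continuous_borelRV => x; exact: coord_continuous. Qed.

Lemma cube_bigcap x r : cube x r = \bigcap_(i in [set: 'I_m]) ((fun y => y ord0 i) @^-1` seg (x ord0 i) r).
Proof. by apply/seteqP; split => y h i; [move=> _; exact: h|exact: h]. Qed.

Lemma measurable_cube x r : measurable (cube x r : set (borelRV R m)).
Proof.
rewrite cube_bigcap; apply: fin_bigcap_measurable => // i _.
rewrite -[X in measurable X]setTI; apply: measurable_coord => //.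
exact: measurable_segment.
Qed.

(** A countable family of cubes with rational centres and radii. It reduces measurability of
    vector-valued maps, and nullity of the complement of a support, to countably many cubes. *)
Lemma cube_basis : exists F : nat -> set 'rV[R]_m,
  (forall n, exists x r, F n = cube x r) /\
  forall x U, open_nbhs x U -> exists2 n, F n x & F n `<=` U.
Proof.
(* An enumeration of the countable type of pairs; the default is harmless, since it still yields a
   cube. *)
pose p n : 'rV[rat]_m * rat := odflt (0, 0) (unpickle n).
exists (fun n => cube (map_mx ratr (p n).1) (ratr (p n).2)); split=> [n|x U].
  by exists (map_mx ratr (p n).1), (ratr (p n).2).
move/open_nbhs_nbhs; rewrite -nbhs_ballE => -[e /= e0 eU].
have e20 : 0 < e / 2 by rewrite divr_gt0.
have [q /itvP qe] : exists q : rat, ratr q \in `]0, (e / 2)[ by exact: rat_in_itvoo.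
have q0 : 0 < ratr q :> R by rewrite qe.
(* A centre within [q] of [x] and radius q < e/2 keep the cube inside the ball of radius [e] around
   [x]. *)
have /choice[z zx] : forall i, exists z : rat, ratr z \in `](x ord0 i - ratr q), (x ord0 i + ratr q)[.
  by move=> i; apply: rat_in_itvoo; lra.
exists (pickle (\row_i z i, q)); rewrite /p pickleK /=.
  by move=> i; rewrite !mxE; have := zx i; rewrite in_itv/= ler_distl; lra.
move=> y hy; apply: eU; split=> // i j; rewrite ord1 -ball_normE /=.
have := hy j; have := zx j; rewrite !mxE in_itv/= ler_distl ltr_distl.
have : ratr q < e / 2 by rewrite qe.
lra.
Qed.

(** An open set is the countable union of the basic cubes inside it, and the preimage of a cube is a
    finite intersection of coordinate conditions. *)
Lemma measurable_fun_borelRV d (T : measurableType d) (f : T -> borelRV R m) :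
  (forall i, measurable_fun setT (fun t => f t ord0 i : R)) ->
  measurable_fun setT f.
Proof.
move=> mf; have [F [Fcube Fbasis]] := cube_basis.
have mfF n : measurable (f @^-1` F n).
  have [x [r ->]] := Fcube n.
  rewrite cube_bigcap preimage_bigcap; apply: fin_bigcap_measurable => // i _.
  rewrite -[X in measurable X]setTI; apply: (mf i) => //.
  exact: measurable_segment.
apply: (@measurability _ _ T (borelRV R m) setT f (@open 'rV[R]_m)) => // _ [U oU <-]; rewrite setTI.
rewrite (_ : f @^-1` U = \bigcup_(n in [set n | F n `<=` U]) (f @^-1` F n)).
  exact: bigcup_measurable.
apply/seteqP; split=> [t Ut|t [n /= FU Ft]]; last exact: FU.
by have [n Fn FU] := Fbasis (f t) U (conj oU Ut); exists n.
Qed.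

End cubes.

Section support.
Context (R : realType) (m : nat) (mu : probability (borelRV R m) R).

Lemma open_setC_supp : open (~` supp mu).
Proof.
rewrite openE => x /= /existsNP[U /not_implyP[[oU Ux] /negP U0]].
rewrite /interior nbhsE/=; exists U => // y Uy /(_ U (conj oU Uy)).
exact/negP.
Qed.

Lemma measurable_open (U : set 'rV[R]_m) : open U ->
  measurable (U : set (borelRV R m)).
Proof. exact: sub_sigma_algebra. Qed.

(** A point outside the support has a null neighbourhood, hence lies in a null basic cube; there are
    only countably many of these. *)
Lemma supp_null : mu (~` supp mu) = 0%E.
Proof.
have [F [Fcube Fbasis]] := @cube_basis R m.
have mF n : measurable (F n : set (borelRV R m)).
  by have [x [r ->]] := Fcube n; exact: measurable_cube.
have : mu.-negligible (\bigcup_n (if mu (F n) == 0%E then F n else set0)).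
  apply: negligible_bigcup => k; case: ifPn => [/eqP Fk|_]; last exact: negligible_set0.
  by exists (F k); split.
move=> [N [mN N0 FN]].
apply/eqP; rewrite eq_le measure_ge0 andbT -N0 le_measure ?inE//.
  exact: measurable_open open_setC_supp.
move=> x /= /existsNP[U /not_implyP[oUx /negP U0]]; apply: FN.
have [n Fn FU] := Fbasis x U oUx; exists n => //.
rewrite ifT// eq_le measure_ge0 andbT (le_trans _ (_ : mu U <= 0)%E)//.
  by rewrite le_measure ?inE//; exact: measurable_open oUx.1.
by rewrite leNgt.
Qed.

Lemma supp_meets (A : set (borelRV R m)) : measurable A -> (0 < mu A)%E ->
  supp mu `&` A !=set0.
Proof.
move=> mA A0; apply/set0P/negP => /eqP sA.
move: A0; rewrite ltNge => /negP; apply.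
rewrite -supp_null le_measure ?inE//; first exact: measurable_open open_setC_supp.
by move=> x Ax sx; have : (supp mu `&` A) x by []; rewrite sA.
Qed.

End support.

(** * Product laws *)

Lemma exists_pushforward d d' (T : measurableType d) (T' : measurableType d')
    (R : realType) (P : probability T R) (f : T -> T') :
  measurable_fun setT f ->
  exists Q : probability T' R, (Q : set T' -> \bar R) = pushforward P f.
Proof.
move=> mf; pose f_mixin := isMeasurableFun.Build _ _ _ _ f mf.
pose F : {mfun T >-> T'} := HB.pack f f_mixin.
by exists (distribution P F).
Qed.

(** Induction on the dimension, one independent coordinate being added in front. In dimension 0
    every cube is the whole space and the empty product is 1. *)
Lemma exists_product_law (R : realType) (P : probability (measurableTypeR R) R)
    (m : nat) :
  exists L : probability (borelRV R m) R, forall x r,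
    L (cube x r) = (\prod_(i < m) fine (P (seg (x ord0 i) r)))%:E.
Proof.
elim: m => [|m [L LE]].
  exists (\d_(0 : borelRV R 0)) => x r; rewrite big_ord0 /= diracE mem_set//.
  by case.
(* The new sample [t.2] becomes coordinate 0, and [t.1] fills the others. *)
pose f (t : borelRV R m * measurableTypeR R) : borelRV R m.+1 :=
  \row_j oapp (fun i => t.1 ord0 i) t.2 (unlift ord0 j).
have mf : measurable_fun setT f.
  apply: measurable_fun_borelRV => j.
  have [i ji|j0] := unliftP ord0 j.
    rewrite (_ : (fun t => _) = (fun y : borelRV R m => y ord0 i : R) \o fst).
      exact: measurableT_comp (measurable_coord i) measurable_fst.
    by apply/funext => t; rewrite /f mxE ji liftK.
  rewrite (_ : (fun t => _) = snd); first exact: measurable_snd.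
  by apply/funext => t; rewrite /f mxE j0 unlift_none.
have [Q QE] := exists_pushforward (L \x P)%E mf.
exists Q => x r; rewrite QE /pushforward.
have -> : f @^-1` cube x r =
    cube (\row_i x ord0 (lift ord0 i)) r `*` seg (x ord0 ord0) r.
  apply/seteqP; split=> [[y t] h|[y t] [/= h1 h2] j].
    split=> [i|] /=; last by have := h ord0; rewrite /f mxE unlift_none.
    by have := h (lift ord0 i); rewrite /f !mxE liftK.
  have [i ->|->] := unliftP ord0 j; rewrite /f mxE ?liftK ?unlift_none//=.
  by have := h1 i; rewrite mxE.
have := product_measure1E L P (measurable_cube (\row_i x ord0 (lift ord0 i)) r)
  (measurable_segment (x ord0 ord0) r).
move=> /= ->.
rewrite LE big_ord_recl -[X in (_ * X)%E]fineK; last first.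
  by apply: fin_num_measure; exact: measurable_segment.
rewrite -EFinM mulrC; congr (_ * _)%:E.
by apply: eq_bigr => i _; rewrite mxE.
Qed.

(** Exponents add over independent coordinates, so each receives beta/m and the growth constants
    multiply to c^m. For [m = 0] the convention that 0 is its own inverse gives [s = 0], consistent
    with [beta = 0]. *)
Lemma exists_law_cube (R : realType) (m : nat) (beta : R) : 0 <= beta <= m%:R ->
  exists (L : probability (borelRV R m) R) (c : R), [/\ 0 < c,
    forall x r r', 0 < r -> r < r' -> r' <= 1 ->
      ((c * (r' / r) `^ beta)%:E * L (cube x r) <= L (cube x r'))%E,
    forall r, 0 < r <= 1 -> ((r `^ beta)%:E <= L (cube 0 r))%E &
    L (cube 0 1) = 1%E].
Proof.
move=> /andP[b0 bm]; pose s := beta / m%:R.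
have s01 : 0 <= s <= 1.
  rewrite /s divr_ge0//=; have [->|m0] := eqVneq m 0; first by rewrite invr0 mulr0.
  by rewrite ler_pdivrMr ?mul1r// ltr0n lt0n.
have sm (a : R) : 0 <= a -> a `^ beta = \prod_(i < m) a `^ s.
  move=> a0; rewrite prodr_const card_ord -powR_mulrn ?powR_ge0// -powRrM.
  congr (_ `^ _); rewrite /s; have [m0|m0] := eqVneq m 0; last first.
    by rewrite divfK// pnatr_eq0.
  by move: bm; rewrite m0 mulr0 => bm; apply/eqP; rewrite eq_le bm.
have [P [c [c0 Pgrow P0 P1]]] := exists_law_exponent s01.
have [L LE] := exists_product_law P m.
have fP x r : P (seg x r) \is a fin_num by apply: fin_num_measure; exact: measurable_segment.
exists L, (c ^+ m); split.
- exact: exprn_gt0.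
- move=> x r r' r0 rr' r'1; rewrite !LE -EFinM lee_fin.
  rewrite sm; last by rewrite divr_ge0 ?(ltW r0) ?(ltW (lt_trans r0 rr')).
  have -> : c ^+ m = \prod_(i < m) c by rewrite prodr_const card_ord.
  rewrite -!big_split/=.
  apply: ler_prod => i _; rewrite !mulr_ge0 ?powR_ge0 ?(ltW c0) ?fine_ge0//=.
  by rewrite -lee_fin EFinM !fineK//; exact: Pgrow.
- move=> r r01; have /andP[r0 _] := r01; rewrite LE lee_fin sm ?(ltW r0)//.
  by apply: ler_prod => i _; rewrite powR_ge0/= mxE -lee_fin fineK//; exact: P0.
- by rewrite LE big1// => i _; rewrite mxE P1.
Qed.

(** * Lower dimension from the measure of cubes *)

Lemma powR_small (R : realType) (g A d : R) : 0 < g -> 0 < A -> 0 < d ->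
  exists2 r, 0 < r < d & r `^ g < A.
Proof.
move=> g0 A0 d0; exists (Num.min (d / 2) ((A / 2) `^ g^-1)).
  by rewrite lt_min gt_min powR_gt0 ?divr_gt0//=; apply/orP; left; lra.
apply: (@le_lt_trans _ _ (A / 2)); last by lra.
have A20 : 0 < A / 2 by rewrite divr_gt0.
rewrite -[leRHS]powRr1 ?(ltW A20)// -[X in _ <= _ `^ X](@mulVf _ g) ?gt_eqF// powRrM.
apply: ge0_ler_powR; rewrite ?nnegrE ?powR_ge0 ?(ltW g0)//.
  by rewrite le_min powR_ge0 divr_ge0// ltW.
by rewrite ge_min lexx orbT.
Qed.

(** * Comparison of Euclidean balls with cubes *)

Section enorm.
Context (R : realType) (m : nat).
Implicit Types x y : 'rV[R]_m.

Lemma coord_le_enorm x i : `|x ord0 i| <= enorm x.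
Proof.
rewrite -sqrtr_sqr; apply: ler_wsqrtr.
by rewrite (bigD1 i)//= lerDl sumr_ge0// => j _; exact: sqr_ge0.
Qed.

Lemma enorm_le x (a : R) : 0 <= a -> (forall i, `|x ord0 i| <= a) ->
  enorm x <= m%:R * a.
Proof.
move=> a0 xa; apply: le_trans (enorm_le_mx_norm _) _; apply: ler_wpM2l => //.
rewrite [leLHS]/Num.norm/= mx_normrE; apply: bigmax_le => // -[i j] _.
by rewrite ord1; exact: xa.
Qed.

Lemma ecball_sub_cube x r : ecball x r `<=` cube x r.
Proof.
move=> y /= yx i; have := coord_le_enorm (y - x) i; rewrite !mxE => h.
exact: le_trans yx.
Qed.

(** The crude bound by [m] times the sup norm is enough; [m.+1] keeps the divisor nonzero in
    dimension 0. *)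
Lemma cube_sub_ecball x r : 0 <= r -> cube x (r / m.+1%:R) `<=` ecball x r.
Proof.
move=> r0 y yx /=; have rm0 : 0 <= r / m.+1%:R by rewrite divr_ge0.
apply: le_trans (@enorm_le (y - x) _ rm0 _) _.
  by move=> i; rewrite !mxE; exact: yx.
by rewrite mulrCA ler_piMr// ler_pdivrMr// mul1r ler_nat.
Qed.

Lemma cube_subset x r r' : r <= r' -> cube x r `<=` cube x r'.
Proof. by move=> rr y yx i; exact: le_trans (yx i) rr. Qed.

Lemma ecball_subset x r r' : r <= r' -> ecball x r `<=` ecball x r'.
Proof. by move=> rr y yx; exact: le_trans yx rr. Qed.

Lemma measurable_ecball x r : measurable (ecball x r : set (borelRV R m)).
Proof.
rewrite (_ : ecball x r = (fun y => enorm (y - x)) @^-1` `]-oo, r]); last first.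
  by apply/seteqP; split => y; rewrite /= in_itv.
rewrite -[X in measurable X]setTI.
have ch : continuous (fun y : 'rV[R]_m => enorm (y - x)).
  move=> y; apply: (@continuous_comp _ _ _ (fun y => y - x) (@enorm R m)).
    exact: (cvgB cvg_id (cvg_cst x)).
  exact: continuous_enorm.
exact: (measurable_continuous_borelRV ch).
Qed.

End enorm.

Section lower_dim_from_cubes.
Context (R : realType) (m : nat) (nu : probability (borelRV R m) R).
Context (beta c c' D K : R) (x0 : 'rV[R]_m).
Hypotheses (beta0 : 0 <= beta) (c0 : 0 < c) (c'0 : 0 < c') (D0 : 0 < D) (K0 : 0 <= K).
Hypothesis growth : forall x r r', 0 < r -> r < r' -> r' <= D ->
  ((c * (r' / r) `^ beta)%:E * nu (cube x r) <= nu (cube x r'))%E.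
Hypothesis mass : forall r, 0 < r <= D -> ((c' * r `^ beta)%:E <= nu (cube x0 r))%E.
Hypothesis bounded : nu (cube 0 K) = 1%E.

Let mcube := @measurable_cube R m.
Let mecball := @measurable_ecball R m.

Let le_nu (A B : set (borelRV R m)) :
  measurable A -> measurable B -> A `<=` B -> (nu A <= nu B)%E.
Proof. by move=> mA mB AB; apply: le_measure; rewrite ?inE. Qed.

Lemma supp_sub_cube : supp nu `<=` cube 0 K.
Proof.
move=> x sx i; rewrite mxE subr0 leNgt; apply/negP => Kx.
pose h (y : 'rV[R]_m) : R := `|y ord0 i|.
have ch : continuous h.
  move=> y; apply: (@continuous_comp _ _ _ (fun y : 'rV[R]_m => y ord0 i) (@Num.norm _ R)).
    exact: coord_continuous.
  exact: norm_continuous.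
have oU : open (h @^-1` `]K, +oo[).
  by move/continuousP : ch; apply; exact: interval_open.
have Ux : (h @^-1` `]K, +oo[) x by rewrite /= in_itv/= Kx.
have := sx _ (conj oU Ux); rewrite ltNge => /negP; apply.
have <- : nu (~` cube 0 K) = 0%E by rewrite probability_setC// bounded subee.
apply: le_nu; [exact: measurable_open|exact: measurableC|].
by move=> y; rewrite /= in_itv/= andbT ltNge => /negP hy /(_ i); rewrite mxE subr0.
Qed.

Lemma diam_le : (diam (supp nu) <= (m%:R * (2 * K))%:E)%E.
Proof.
apply: ge_ereal_sup => _ [[p q] [/= /supp_sub_cube hp /supp_sub_cube hq] <-].
rewrite lee_fin; apply: enorm_le; first by rewrite mulr_ge0.
move=> i; have := hp i; have := hq i; rewrite !mxE !subr0 => h1 h2.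
by rewrite (le_trans (ler_normB _ _))//; lra.
Qed.

(** Shrinking r' by the factor [a] does two things at once: the cube of radius a r' fits in the ball
    of radius r', and a r' <= D makes [growth] applicable. If r >= a r', the ratio r'/r is at most
    1/a and monotonicity suffices; the minimum with 1 in [M] serves that case. *)
Lemma ecball_growth (B : R) : 0 < B -> exists2 M : R, 0 < M &
  forall x r r', 0 < r -> r < r' -> r' <= B ->
  ((M * (r' / r) `^ beta)%:E * nu (ecball x r) <= nu (ecball x r'))%E.
Proof.
move=> B0; pose a := Num.min m.+1%:R^-1 (D / B).
have a0 : 0 < a by rewrite lt_min invr_gt0 ltr0n/= divr_gt0.
exists (Num.min c 1 * a `^ beta).
  by rewrite mulr_gt0 ?powR_gt0// lt_min c0 ltr01.
move=> x r r' r0 rr' r'B; have r'0 := lt_trans r0 rr'.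
have -> : Num.min c 1 * a `^ beta * (r' / r) `^ beta =
    Num.min c 1 * (a * r' / r) `^ beta.
  by rewrite -[a * r' / r]mulrA [in RHS]powRM ?divr_ge0 ?(ltW r0) ?(ltW r'0) ?(ltW a0)// mulrA.
have ar'0 : 0 < a * r' by rewrite mulr_gt0.
have [rt|tr] := ltP r (a * r').
  have t1 : a * r' <= r' / m.+1%:R.
    by rewrite mulrC ler_wpM2l ?(ltW r'0)// ge_min lexx.
  have t2 : a * r' <= D.
    apply: (@le_trans _ _ (a * B)); first by rewrite ler_wpM2l// ltW.
    by rewrite -ler_pdivlMr// ge_min lexx orbT.
  apply: le_trans (le_nu (mcube _ _) (mecball _ _) (cube_sub_ecball (ltW r'0))).
  apply: le_trans (le_nu (mcube _ _) (mcube _ _) (cube_subset t1)).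
  apply: le_trans (growth x r0 rt t2).
  apply: lee_pmul; rewrite ?measure_ge0 ?lee_fin//.
  - by rewrite mulr_ge0 ?powR_ge0// le_min (ltW c0) ler01.
  - by apply: ler_wpM2r; [exact: powR_ge0|rewrite ge_min lexx].
  - by apply: le_nu => //; exact: ecball_sub_cube.
apply: (@le_trans _ _ (1%:E * nu (ecball x r))%E); last first.
  by rewrite mul1e; apply: le_nu => //; apply: ecball_subset; exact: ltW.
apply: lee_wpmul2r; rewrite ?measure_ge0// lee_fin.
apply: mulr_ile1; rewrite ?powR_ge0//.
- by rewrite le_min (ltW c0) ler01.
- by rewrite ge_min lexx orbT.
- rewrite [leRHS](_ : 1 = 1 `^ beta); last by rewrite powR1.
  apply: ge0_ler_powR; rewrite ?nnegrE ?divr_ge0 ?(ltW r0) ?(ltW ar'0)//.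
  by rewrite ler_pdivrMr// mul1r.
Qed.

Let massgt0 r : 0 < r -> (0 < nu (cube x0 r))%E.
Proof.
move=> r0; pose t := Num.min r D.
have t0 : 0 < t by rewrite lt_min r0.
apply: (@lt_le_trans _ _ (c' * t `^ beta)%:E).
  by rewrite lte_fin mulr_gt0 ?powR_gt0.
apply: le_trans (mass _) (le_nu (mcube _ _) (mcube _ _) (cube_subset _)).
  by rewrite t0 ge_min lexx orbT.
by rewrite ge_min lexx.
Qed.

Lemma center_in_supp : supp nu x0.
Proof.
move=> U [oU U0]; have : nbhs x0 U by exact: open_nbhs_nbhs.
rewrite -nbhs_ballE => -[e /= e0 eU].
apply: lt_le_trans (@massgt0 (e / 2) _) _; first by rewrite divr_gt0.
apply: le_nu => //; first exact: measurable_open.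
move=> y hy; apply: eU; split=> // i j; rewrite ord1 -ball_normE /= distrC.
by apply: le_lt_trans (hy j) _; lra.
Qed.

(** An atom of mass p at [x0] would give 1 >= c (D/r)^beta p for all small r, which fails as r tends
    to 0. This makes the support more than a point, so that [lower_dim] is not in its default
    branch. *)
Lemma center_not_atom : 0 < beta -> nu (cube x0 0) = 0%E.
Proof.
move=> b0; apply/eqP; rewrite eq_le measure_ge0 andbT leNgt; apply/negP => p0.
have fp : nu (cube x0 0) \is a fin_num by exact: fin_num_measure.
have p1 : 0 < fine (nu (cube x0 0)).
  by rewrite fine_gt0// p0/= ltey_eq fp.
have A0 : 0 < fine (nu (cube x0 0)) * c * D `^ beta.
  by rewrite !mulr_gt0// powR_gt0.
have [r /andP[r0 rD] rA] := powR_small b0 A0 D0.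
have : ((c * (D / r) `^ beta)%:E * nu (cube x0 0) <= 1)%E.
  apply: le_trans (_ : (c * (D / r) `^ beta)%:E * nu (cube x0 r) <= 1)%E.
    apply: lee_wpmul2l; first by rewrite lee_fin mulr_ge0 ?powR_ge0 ?(ltW c0).
    by apply: le_nu => //; apply: cube_subset; exact: ltW.
  by apply: le_trans (growth _ r0 rD (lexx _)) _; apply: probability_le1.
rewrite -(fineK fp) -EFinM lee_fin powRM ?invr_ge0 ?(ltW D0) ?(ltW r0)//.
rewrite -powR_inv1 ?(ltW r0)// powRAC powR_inv1 ?powR_ge0//.
have rb0 : 0 < r `^ beta by rewrite powR_gt0.
rewrite mulrA mulrAC ler_pdivrMr// mul1r; lra.
Qed.

Lemma diam_gt0 : 0 < beta -> (0 < diam (supp nu))%E.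
Proof.
move=> b0; have [||y [sy ny]] := @supp_meets _ _ nu (~` cube x0 0).
- exact: measurableC.
- by rewrite probability_setC// center_not_atom// sube0 lte01.
have [i hi] : exists i, 0 < `|(y - x0) ord0 i|.
  by move: ny => /existsNP[i /negP]; rewrite -ltNge => h; exists i; rewrite !mxE.
apply: (@lt_le_trans _ _ (enorm (y - x0))%:E).
  by rewrite lte_fin (lt_le_trans hi)// coord_le_enorm.
apply: ereal_sup_ubound; exists (y, x0) => //; split => //.
exact: center_in_supp.
Qed.

Lemma mem_lower_exponents : lower_exponents nu beta.
Proof.
(* The scales to treat are bounded by the diameter, hence by [diam_le]; adding 1 keeps the bound
   positive. *)
split=> //; have B0 : 0 < m%:R * (2 * K) + 1 :> R by rewrite ltr_wpDl// !mulr_ge0.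
have [M M0 hM] := ecball_growth B0; exists M => // r r' x r0 rr' r'd sx.
have fB t : nu (ecball x t) \is a fin_num by exact: fin_num_measure.
(* Positivity of the denominator, needed to clear the quotient; this is where [x] in the support is
   used. *)
have Br0 : 0 < fine (nu (ecball x r)).
  rewrite fine_gt0// [X in _ && X]ltey_eq fB andbT.
  have h : (0 < nu (cube x (r / m.+1%:R)))%E.
    have rm0 : 0 < r / m.+1%:R by rewrite divr_gt0.
    apply: lt_le_trans (_ : nu (ball x (r / m.+1%:R)) <= _)%E; last first.
      apply: le_nu => //; first exact: measurable_open (ball_open x _).
      by move=> y [_ xy] i; rewrite distrC; have := xy ord0 i; rewrite -ball_normE /= => /ltW.
    exact: sx (ball_open_nbhs x rm0).
  apply: lt_le_trans h (le_nu (mcube _ _) (mecball _ _) _).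
  by apply: cube_sub_ecball; exact: ltW.
rewrite ler_pdivlMr// -lee_fin EFinM !fineK//; apply: hM => //.
have := le_trans r'd diam_le; rewrite lee_fin => h; lra.
Qed.

(** Fix a large radius [r0] at [x0]. An exponent b > beta, together with [mass], would bound the
    mass of that ball below by a constant times r^(beta - b), which exceeds 1 for small r. *)
Lemma lower_exponents_le b : (0 < diam (supp nu))%E ->
  lower_exponents nu b -> b <= beta.
Proof.
move=> d0 [b0 [M M0 hM]]; rewrite leNgt; apply/negP => bb.
have [r0 r00 r0d] : exists2 r0 : R, 0 < r0 & (r0%:E <= diam (supp nu))%E.
  case: (diam (supp nu)) d0 => [d| |]//; first by exists d.
  by exists 1 => //; rewrite leey.
pose k : R := m.+1%:R; have k0 : 0 < k by rewrite ltr0n.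
have kb0 : 0 < k^-1 `^ beta by rewrite powR_gt0// invr_gt0.
(* This is the constant just mentioned; k^-1 comes from inscribing a cube in the small ball. *)
have A0 : 0 < M * r0 `^ b * (c' * k^-1 `^ beta).
  by rewrite !mulr_gt0// powR_gt0.
have d0' : 0 < Num.min r0 D by rewrite lt_min r00.
have bb0 : 0 < b - beta by rewrite subr_gt0.
have [r /andP[rgt0 rd] rA] := powR_small bb0 A0 d0'.
move: rd; rewrite lt_min => /andP[rr0 rD].
have := hM r r0 x0 rgt0 rr0 r0d center_in_supp.
have fB t : nu (ecball x0 t) \is a fin_num by exact: fin_num_measure.
have lowB : c' * (r / k) `^ beta <= fine (nu (ecball x0 r)).
  rewrite -lee_fin fineK//.
  apply: le_trans (le_nu (mcube _ _) (mecball _ _) (cube_sub_ecball (ltW rgt0))).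
  apply: mass; rewrite divr_gt0//= ler_pdivrMr//.
  by rewrite (le_trans (ltW rD))// ler_peMr ?(ltW D0)// ler1n.
have low0 : 0 < c' * (r / k) `^ beta by rewrite mulr_gt0 ?powR_gt0 ?divr_gt0.
apply/negP; rewrite -ltNge ltr_pdivrMr; last exact: lt_le_trans lowB.
apply: (@le_lt_trans _ _ 1).
  by rewrite -lee_fin fineK//; exact: probability_le1.
have rb0 : 0 < r `^ b by rewrite powR_gt0.
have h1 : 1 < M * (r0 / r) `^ b * (c' * (r / k) `^ beta).
  have -> : M * (r0 / r) `^ b * (c' * (r / k) `^ beta) =
      M * r0 `^ b * (c' * k^-1 `^ beta) * (r `^ (b - beta))^-1.
    rewrite [(r0 / r) `^ b]powRM ?invr_ge0 ?(ltW r00) ?(ltW rgt0)//.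
    rewrite [(r / k) `^ beta]powRM ?invr_ge0 ?(ltW k0) ?(ltW rgt0)//.
    rewrite -[r^-1]powR_inv1 ?(ltW rgt0)// powRAC powR_inv1 ?powR_ge0//.
    rewrite powRB; last by rewrite (gt_eqF rgt0) implybT.
    by field; rewrite !gt_eqF// powR_gt0.
  by rewrite ltr_pdivlMr ?powR_gt0// mul1r.
apply: lt_le_trans h1 _; apply: ler_wpM2l => //.
by rewrite mulr_ge0 ?powR_ge0 ?(ltW M0).
Qed.

Lemma lower_dim_eq : lower_dim nu = beta%:E.
Proof.
(* A support of zero diameter forces [beta = 0] by [diam_gt0], which is the conventional value. *)
rewrite /lower_dim; case: ifPn => [d0|d0]; last first.
  have := beta0; rewrite le_eqVlt => /predU1P[<-//|/diam_gt0 h].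
  by rewrite h in d0.
apply/eqP; rewrite eq_le; apply/andP; split.
  by apply: ge_ereal_sup => _ [b hb <-]; rewrite lee_fin; exact: lower_exponents_le.
by apply: ereal_sup_ubound; exists beta => //; exact: mem_lower_exponents.
Qed.

End lower_dim_from_cubes.

(** * Couplings and the Kantorovich distance *)

Lemma measurable_enorm (R : realType) (m : nat) :
  measurable_fun setT (@enorm R m : borelRV R m -> R).
Proof. exact: measurable_continuous_borelRV (@continuous_enorm R m). Qed.

(** Dominated convergence along growing cubes, with the integrable majorant [enorm x + C]. Later [C]
    is the norm of the point to which the tail is moved. *)
Lemma moment_tail (R : realType) (m : nat) (mu : Omega R m) (C eta : R) :
  0 <= C -> 0 < eta -> exists2 K : R, 0 <= K &
  (\int[mu]_x (\1_(~` cube 0 K) x * (enorm x + C))%:E <= eta%:E)%E.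
Proof.
move=> C0 eta0.
pose f_ (n : nat) (x : borelRV R m) : \bar R :=
  (\1_(~` cube 0 n%:R) x * (enorm x + C))%:E.
have h0 (x : 'rV[R]_m) : 0 <= enorm x + C by rewrite addr_ge0// enorm_ge0.
have : (\int[mu]_x f_ n x @[n --> \oo] --> \int[mu]_x (cst 0 x))%E.
  apply: (@dominated_cvg _ _ _ mu setT measurableT f_ (cst 0%E)
    (fun x => (enorm x + C)%:E)) => //.
  - move=> n; apply/measurable_EFinP/measurable_funM.
      by apply: measurable_indic; apply: measurableC; exact: measurable_cube.
    by apply: measurable_funD => //; exact: measurable_enorm.
  - move=> x _; apply: cvg_near_cst; near=> n.
    rewrite /f_ indicE memNset ?mul0r//=; apply; move=> i.
    rewrite mxE subr0 (le_trans (coord_le_enorm _ _))//.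
    by near: n; exact: nbhs_infty_ger.
  - rewrite (_ : (fun x => _) = (EFin \o @enorm R m) \+ (EFin \o cst C))%E//.
    apply: integrableD => //; last exact: finite_measure_integrable_cst.
    apply/integrableP; split.
      by apply/measurable_EFinP; exact: measurable_enorm.
    apply: le_lt_trans (law_moment mu); rewrite le_eqVlt; apply/orP; left.
    by apply/eqP/eq_integral => x _ /=; rewrite ger0_norm ?enorm_ge0.
  - move=> n x _; rewrite /f_ abse_EFin lee_fin normrM (ger0_norm (h0 x)).
    by rewrite ler_piMl// indicE; case: (_ \in _); rewrite ?normr1 ?normr0.
rewrite integral0 => /fine_cvgP[finI /cvgrPdist_lt/(_ _ eta0)] tail.
near \oo => n; exists n%:R => //.
have fn : (\int[mu]_x f_ n x)%E \is a fin_num by near: n.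
rewrite -[leLHS](fineK fn) lee_fin.
have : `|0 - fine (\int[mu]_x f_ n x)%E| < eta by near: n.
by rewrite sub0r normrN => /ltW; apply: le_trans; exact: ler_norm.
Unshelve. all: by end_near. Qed.

Lemma integrable_comp_pushforward d d' (T : measurableType d)
    (T' : measurableType d') (R : realType) (mu : {measure set T -> \bar R})
    (phi : T -> T') (f : T' -> \bar R) : measurable_fun setT phi ->
  (pushforward mu phi).-integrable setT f -> mu.-integrable setT (f \o phi).
Proof.
move=> mphi /integrableP[mf if_]; apply/integrableP; split.
  exact: measurableT_comp.
move: if_; rewrite ge0_integral_pushforward//.
exact: measurableT_comp.
Qed.

(** The easy half of Kantorovich duality: |E h(X) - E h(Y)| <= E |h(X) - h(Y)|, and the Lipschitz
    bound costs [m] when passing from coordinates to the Euclidean norm. An almost-everywhere bound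
    is asked because the noise is only almost surely in the unit cube. *)
Lemma dL_coupling (R : realType) (m : nat) (mu nu : Omega R m) d
    (T : measurableType d) (P : probability T R) (X Y : T -> borelRV R m)
    (G : T -> R) :
  measurable_fun setT X -> measurable_fun setT Y -> measurable_fun setT G ->
  (forall A, measurable A -> mu A = pushforward P X A) ->
  (forall A, measurable A -> nu A = pushforward P Y A) ->
  (forall t, 0 <= G t) ->
  {ae P, forall t, forall i, `|X t ord0 i - Y t ord0 i| <= G t} ->
  (dL mu nu <= m%:R%:E * \int[P]_t (G t)%:E)%E.
Proof.
move=> mX mY mG muE nuE G0 XYG; apply: ge_ereal_sup => _ [h hh <-].
have mh := measurable_continuous_borelRV (Lip1_continuous hh).
have mhE : measurable_fun setT (EFin \o h : borelRV R m -> \bar R).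
  exact/measurable_EFinP.
have transfer (xi : Omega R m) (Z : T -> borelRV R m) (mZ : measurable_fun setT Z) :
    (forall A, measurable A -> xi A = pushforward P Z A) ->
    P.-integrable setT (EFin \o (h \o Z)) /\
    (\int[xi]_x (h x)%:E = \int[P]_t (h (Z t))%:E)%E.
  move=> xiE; have [Q QE] := exists_pushforward P mZ.
  have QA A : Q A = pushforward P Z A by rewrite QE.
  have iQ : Q.-integrable setT (EFin \o h).
    have /integrableP[_ ih] := Lip1_integrable xi hh.
    apply/integrableP; split => //; apply: le_lt_trans ih.
    rewrite le_eqVlt; apply/orP; left; apply/eqP; apply: eq_measure_integral => A mA _.
    by apply: etrans (QA A) _; exact/esym/xiE.
  have iP : P.-integrable setT (EFin \o (h \o Z)).
    have iPZ : (pushforward P Z).-integrable setT (EFin \o h) by rewrite -QE.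
    exact: (integrable_comp_pushforward mZ iPZ).
  split => //; rewrite -(@integral_pushforward _ _ _ _ _ _ mZ P setT (EFin \o h))//.
  by apply: eq_measure_integral => A mA _; exact: xiE.
have [iX EX] := transfer mu X mX muE.
have [iY EY] := transfer nu Y mY nuE.
have -> : \int[mu]_x h x - \int[nu]_x h x = \int[P]_t (h (X t) - h (Y t)).
  by rewrite RintegralB// /Rintegral EX EY.
have iXY : P.-integrable setT (EFin \o (fun t => h (X t) - h (Y t))).
  rewrite (_ : EFin \o _ = (EFin \o (h \o X)) \- (EFin \o (h \o Y)))%E//.
  exact: integrableB.
have mXY : measurable_fun setT (fun t => h (X t) - h (Y t)).
  by have /integrableP[/measurable_EFinP] := iXY.
rewrite /Rintegral -abse_EFin fineK; last exact: integrable_fin_num.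
apply: le_trans (le_abse_integral _ _ _) _ => //.
  by have /integrableP[] := iXY.
rewrite -ge0_integralZl_EFin//; last 2 first.
  by move=> t _; rewrite lee_fin.
  exact/measurable_EFinP.
apply: ae_ge0_le_integral => //.
- by apply: measurableT_comp => //; apply/measurable_EFinP.
- by move=> t _; rewrite -EFinM lee_fin mulr_ge0.
- by apply/measurable_EFinP/measurable_funM.
apply: filterS XYG => t XYt _; rewrite /= lee_fin.
apply: le_trans (hh _ _) _; apply: enorm_le => // i.
by rewrite !mxE; exact: XYt.
Qed.

Lemma moment_of_bounded (R : realType) (m : nat) (nu : probability (borelRV R m) R)
    (K : R) : 0 <= K -> nu (cube 0 K) = 1%E ->
  (\int[nu]_x (enorm x)%:E < +oo)%E.
Proof.
move=> K0 nuK; have nuC : nu (~` cube 0 K) = 0%E.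
  by rewrite probability_setC ?nuK ?subee//; exact: measurable_cube.
apply: (@le_lt_trans _ _ (\int[nu]_x cst (m%:R * K)%:E x)%E).
  apply: ae_ge0_le_integral => //.
  - by move=> x _; rewrite lee_fin enorm_ge0.
  - by apply/measurable_EFinP; exact: measurable_enorm.
  - by move=> x _; rewrite lee_fin mulr_ge0.
  exists (~` cube 0 K); split.
  - by apply: measurableC; exact: measurable_cube.
  - exact: nuC.
  move=> x; apply: contra_not => xK _; rewrite lee_fin.
  by apply: enorm_le => // i; have := xK i; rewrite mxE subr0.
by rewrite integral_cst//= [X in (_ * X)%E](probability_setT nu) mule1 ltry.
Qed.

(** * The approximating law *)

Section smear.
Context (R : realType) (m : nat) (mu L : probability (borelRV R m) R).
Context (f : borelRV R m -> borelRV R m) (eps : R).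
Hypotheses (mf : measurable_fun setT f) (eps0 : 0 < eps).

Definition smear (t : borelRV R m * borelRV R m) : borelRV R m :=
  (f t.1 : 'rV[R]_m) + eps *: (t.2 : 'rV[R]_m).

Lemma measurable_smear : measurable_fun setT smear.
Proof.
apply: measurable_fun_borelRV => i.
rewrite (_ : (fun t => _) = (fun t : borelRV R m * borelRV R m =>
    f t.1 ord0 i + eps * t.2 ord0 i)); last first.
  by apply/funext => t; rewrite /smear !mxE.
apply: measurable_funD.
  apply: (measurableT_comp (f := fun y : borelRV R m => y ord0 i : R)
    (g := fun t : borelRV R m * borelRV R m => f t.1)).
    exact: measurable_coord.
  exact: measurableT_comp mf measurable_fst.
apply: measurable_funM => //.
exact: measurableT_comp (measurable_coord i) measurable_snd.
Qed.

(** For fixed [z], the noise values that land in a cube form a cube again. Its centre is arbitrary,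
    hence the need for growth of [L] at all points. *)
Lemma smear_cube (x y : 'rV[R]_m) (z : borelRV R m) (r : R) :
  cube x r (smear (z, y)) <-> cube (eps^-1 *: (x - f z)) (r / eps) y.
Proof.
have E i : `|y ord0 i - (eps^-1 *: (x - f z)) ord0 i| * eps =
    `|(smear (z, y)) ord0 i - x ord0 i|.
  rewrite -{2}(gtr0_norm eps0) -normrM !mxE; congr `|_|.
  by field; rewrite gt_eqF.
split=> h i; have := h i; first by rewrite ler_pdivlMr// E.
by rewrite ler_pdivlMr// E.
Qed.

(** By [smear_cube] the inequality holds section by section, since rescaling by [eps] preserves the
    ratio of radii; integrating over [z] concludes. *)
Lemma smear_growth (c beta : R) : 0 < c ->
  (forall x r r', 0 < r -> r < r' -> r' <= 1 ->
    ((c * (r' / r) `^ beta)%:E * L (cube x r) <= L (cube x r'))%E) ->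
  forall x r r', 0 < r -> r < r' -> r' <= eps ->
    ((c * (r' / r) `^ beta)%:E * pushforward (mu \x L)%E smear (cube x r) <=
     pushforward (mu \x L)%E smear (cube x r'))%E.
Proof.
move=> c0 growth x r r' r0 rr' r'e.
have mS (t : R) : measurable (smear @^-1` cube x t).
  by rewrite -[X in measurable X]setTI; apply: measurable_smear => //; exact: measurable_cube.
have sec (t : R) z : xsection (smear @^-1` cube x t) z =
    cube (eps^-1 *: (x - f z)) (t / eps).
  by apply/seteqP; split => y; rewrite /xsection /= inE; move/(smear_cube x y z t).
have a0 : 0 <= c * (r' / r) `^ beta by rewrite mulr_ge0 ?powR_ge0 ?(ltW c0).
rewrite /pushforward /product_measure1 -ge0_integralZl_EFin//; last 1 first.
  exact: measurable_fun_xsection.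
apply: ge0_le_integral => //.
- by move=> z _; rewrite mule_ge0.
- by apply: measurable_funeM; exact: measurable_fun_xsection.
- exact: measurable_fun_xsection.
move=> z _; rewrite /= !sec.
have -> : r' / r = (r' / eps) / (r / eps) by field; rewrite !gt_eqF.
apply: growth; rewrite ?divr_gt0 ?ltr_pM2r ?invr_gt0//.
by rewrite ler_pdivrMr// mul1r.
Qed.

Lemma smear_mass (a : 'rV[R]_m) (A : set (borelRV R m)) (r : R) :
  measurable A -> (forall z, A z -> f z = a) ->
  (mu A * L (cube 0 (r / eps)) <= pushforward (mu \x L)%E smear (cube a r))%E.
Proof.
move=> mA Aa; rewrite -product_measure1E//; last exact: measurable_cube.
rewrite /pushforward; apply: le_measure; rewrite ?inE.
- by apply: measurableX => //; exact: measurable_cube.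
- by rewrite -[X in measurable X]setTI; apply: measurable_smear => //; exact: measurable_cube.
move=> [z y] [/= Az yr]; apply/smear_cube.
by rewrite Aa// subrr scaler0.
Qed.

Lemma smear_bounded (K : R) : (forall z, cube 0 K (f z)) -> L (cube 0 1) = 1%E ->
  pushforward (mu \x L)%E smear (cube 0 (K + eps)) = 1%E.
Proof.
move=> fK L1; apply/eqP; rewrite eq_le; apply/andP; split.
  apply: probability_le1.
  by rewrite -[X in measurable X]setTI; apply: measurable_smear => //; exact: measurable_cube.
have <- : (mu \x L)%E (setT `*` cube 0 1) = 1%E.
  rewrite product_measure1E//; last exact: measurable_cube.
  by rewrite [X in (_ * X)%E]L1 mule1; exact: probability_setT.
apply: le_measure; rewrite ?inE.
- by apply: measurableX => //; exact: measurable_cube.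
- by rewrite -[X in measurable X]setTI; apply: measurable_smear => //; exact: measurable_cube.
move=> [z y] [_ /= yK] i; rewrite /smear/= !mxE subr0.
have := fK z i; have := yK i; rewrite !mxE !subr0 => h1 h2.
apply: le_trans (ler_normD _ _) _; apply: lerD => //.
by rewrite normrM (gtr0_norm eps0) ler_piMr// ltW.
Qed.

End smear.

(** * Truncation to a bounded set with creation of an atom *)

Section collapse.
Context (R : realType) (m : nat) (a : 'rV[R]_m) (d K : R).
Hypotheses (d0 : 0 < d) (K0 : 0 <= K).

Let A : set 'rV[R]_m := ~` cube a d `&` cube 0 K.

Definition collapse (x : borelRV R m) : borelRV R m :=
  if x \in A then x else (a : borelRV R m).

Lemma measurable_collapse : measurable_fun setT collapse.
Proof.
apply: measurable_fun_borelRV => i.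
have mA : measurable (A : set (borelRV R m)).
  by apply: measurableI; [apply: measurableC|]; exact: measurable_cube.
rewrite (_ : (fun t => _) = (fun t : borelRV R m =>
    a ord0 i + \1_A t * (t ord0 i - a ord0 i))); last first.
  apply/funext => t; rewrite /collapse indicE.
  by case: (t \in A); rewrite ?mul1r ?mul0r ?addr0// addrC subrK.
apply: measurable_funD => //; apply: measurable_funM.
  exact: measurable_indic.
by apply: measurable_funB => //; exact: measurable_coord.
Qed.

Lemma collapse_near z : cube a d z -> collapse z = a.
Proof. by move=> az; rewrite /collapse memNset// /A/= => -[]. Qed.

Lemma collapse_bounded z : cube 0 (K + enorm a) (collapse z).
Proof.
move=> i; rewrite mxE subr0 /collapse; case: ifPn => [|_].
  rewrite inE => -[_ /(_ i)]; rewrite mxE subr0 => h.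
  by rewrite (le_trans h)// lerDl enorm_ge0.
by rewrite (le_trans (coord_le_enorm _ _))// lerDr.
Qed.

(** Points near [a] move by at most [d]; points outside the large cube move by at most the sum of
    the norms, which [moment_tail] controls on average. *)
Lemma collapse_dist (z : 'rV[R]_m) i : `|z ord0 i - collapse z ord0 i| <=
  d + \1_(~` cube 0 K) z * (enorm z + enorm a).
Proof.
have e0 : 0 <= enorm z + enorm a by rewrite addr_ge0 ?enorm_ge0.
rewrite /collapse; case: ifPn => [_|].
  by rewrite subrr normr0 addr_ge0 ?(ltW d0)// mulr_ge0// indicE.
rewrite notin_setE => /not_andP[/contrapT za|zK].
  by rewrite (le_trans (za i))// lerDl mulr_ge0// indicE.
rewrite indicE mem_set//= mul1r; apply: le_trans (ler_normB _ _) _.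
apply: ler_wpDl; first exact: ltW.
by apply: lerD; exact: coord_le_enorm.
Qed.

End collapse.

(** * Density of the level sets of the lower dimension *)

Unset Implicit Arguments.

Theorem theorem3p14 (R : realType) (m : nat) (beta : R)
  (hbeta : 0 <= beta <= m%:R) :
  dense (lower_dim_level beta : set (Omega R m)).
Proof.
apply/denseOmegaP => mu e e0.
have [L [c [c0 growth mass L1]]] := exists_law_cube hbeta.
have [a [sa _]] : supp mu `&` setT !=set0.
  by apply: supp_meets => //; rewrite [ltRHS](probability_setT mu) lte01.
have [beta0 _] := andP hbeta.
(* The coupling will cost at most 3 m d, which is e times 3/4 times m/(m+1), hence less than [e]. *)
pose d := e / (4 * m.+1%:R).
have d0 : 0 < d by rewrite divr_gt0// mulr_gt0.
have [K K0 tail] := moment_tail mu (enorm_ge0 a) d0.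
have p0 : (0 < mu (cube a d))%E.
  apply: lt_le_trans (sa _ (ball_open_nbhs a d0)) _.
  apply: le_measure; rewrite ?inE; [exact: measurable_open (ball_open _ _)|exact: measurable_cube|].
  by move=> y [_ ay] i; rewrite distrC; have := ay ord0 i; rewrite -ball_normE /= => /ltW.
have fp : mu (cube a d) \is a fin_num by apply: fin_num_measure; exact: measurable_cube.
(* The collapsed cube turns into an atom of mass at least [p] at [a]. *)
pose p := fine (mu (cube a d)).
have pgt0 : 0 < p by rewrite fine_gt0// [X in X && _]p0 ltey_eq fp.
pose f := collapse a d K; pose Y := smear f d.
have mf : measurable_fun setT f := measurable_collapse a d K.
have mY : measurable_fun setT Y := measurable_smear d mf.
have [Q QE] := exists_pushforward (mu \x L)%E mY.
have QB : Q (cube 0 (K + enorm a + d)) = 1%E.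
  by rewrite QE; apply: smear_bounded => // z; exact: collapse_bounded.
have B0 : 0 <= K + enorm a + d by rewrite !addr_ge0 ?enorm_ge0// ltW.
pose nu : Omega R m := MkOmega (moment_of_bounded B0 QB).
exists nu.
  (* The mass constant is that of the atom times the rescaling in (r/d)^beta; scales up to 1 for [L]
     become scales up to [d]. *)
  apply: (@lower_dim_eq _ _ Q beta c (p * (d^-1) `^ beta) d (K + enorm a + d) a) => //.
  - by rewrite mulr_gt0// powR_gt0// invr_gt0.
  - by move=> x r r' *; rewrite QE; exact: smear_growth.
  move=> r /andP[r0 rd]; rewrite QE.
  have := @smear_mass R m mu L f d mf d0 a (cube a d) r (measurable_cube a d) (fun z => @collapse_near R m a d K z).
  apply: le_trans; rewrite -(fineK fp) -mulrA EFinM; apply: lee_wpmul2l.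
    by rewrite lee_fin ltW.
  rewrite -powRM ?invr_ge0 ?(ltW d0) ?(ltW r0)// mulrC; apply: mass.
  by rewrite divr_gt0//= ler_pdivrMr// mul1r.
pose T (z : borelRV R m) : R := \1_(~` cube 0 K) z * (enorm z + enorm a).
have LC : L (~` cube 0 1) = 0%E.
  by rewrite probability_setC ?L1 ?subee//; exact: measurable_cube.
(* The three displacements: collapse near [a], collapse of the tail, and noise. Each integrates to
   at most [d]. *)
pose G (z : borelRV R m) : R := d + T z + d.
have mT : measurable_fun setT T.
  apply: measurable_funM; last by apply: measurable_funD => //; exact: measurable_enorm.
  by apply: measurable_indic; apply: measurableC; exact: measurable_cube.
have T0 z : 0 <= T z.
  by rewrite mulr_ge0 ?addr_ge0 ?enorm_ge0// indicE.
have mG : measurable_fun setT G by do 2 apply: measurable_funD => //.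
have fstE A : measurable A -> mu A = pushforward (mu \x L)%E fst A.
  move=> mA; rewrite /pushforward (_ : fst @^-1` A = A `*` setT); last first.
    by apply/seteqP; split=> [[x y]|[x y] []].
  rewrite [RHS](@product_measure1E _ _ _ _ _ mu L)//.
  by rewrite [X in (_ * X)%E](probability_setT L) mule1.
have G0 z : 0 <= G z by rewrite !addr_ge0// ltW.
have intG : (\int[mu]_z (G z)%:E <= (3 * d)%:E)%E.
  rewrite (eq_integral (fun z => ((d + d)%:E + (T z)%:E)%E)); last first.
    by move=> z _; rewrite -EFinD /G addrAC.
  rewrite ge0_integralD//; last 3 first.
  - by move=> z _; rewrite lee_fin addr_ge0// ltW.
  - by move=> z _; rewrite lee_fin.
  - exact/measurable_EFinP.
  rewrite integral_cst// [X in (_ * X)%E](probability_setT mu) mule1.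
  rewrite (_ : 3 * d = (d + d) + d); last by ring.
  by rewrite [leRHS]EFinD leeD2l.
apply: (@le_lt_trans _ _ (m%:R * (3 * d))%:E); last first.
  rewrite lte_fin /d.
  rewrite (_ : _ * _ = e * (3 / 4) * (m%:R / m.+1%:R)); last by field.
  have : m%:R / m.+1%:R <= 1 :> R by rewrite ler_pdivrMr// mul1r ler_nat.
  by move: (m%:R / m.+1%:R) => q /(ler_piMr (ltW e0)); lra.
apply: le_trans (@dL_coupling _ _ mu nu _ _ (mu \x L)%E fst Y (G \o fst)
  measurable_fst mY _ fstE _ _ _) _.
- exact: measurableT_comp mG measurable_fst.
- by move=> A mA; rewrite -QE.
- by move=> t; exact: G0.
(* The exceptional null set: noise outside the unit cube. *)
- exists (setT `*` ~` cube 0 1); split.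
  + by apply: measurableX => //; apply: measurableC; exact: measurable_cube.
  + rewrite [LHS](@product_measure1E _ _ _ _ _ mu L)//.
      by rewrite [X in (_ * X)%E]LC mule0.
    by apply: measurableC; exact: measurable_cube.
  move=> [z y] /= h; split => //; apply: contra_not h => y1 i.
  rewrite /Y /smear/= !mxE opprD addrA; apply: le_trans (ler_normB _ _) _.
  apply: lerD; first exact: collapse_dist.
  have := y1 i; rewrite mxE subr0 => yi.
  by rewrite normrM (gtr0_norm d0) ler_piMr// ltW.
rewrite EFinM lee_wpmul2l ?lee_fin//.
(* The bound depends on the first coordinate alone, whose law is [mu]. *)
have <- : (\int[mu]_z (G z)%:E = \int[(mu \x L)%E]_t ((G \o fst) t)%:E)%E.
  rewrite -[RHS](@ge0_integral_pushforward _ _ _ _ _ _ measurable_fst (mu \x L)%E setT (EFin \o G))//.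
  - by apply: eq_measure_integral => A mA _; exact: fstE.
  - exact/measurable_EFinP.
  - by move=> z _; rewrite lee_fin.
exact: intG.
Qed.
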